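(* Every polynomial hypergroup $K_{\mathbf P}$ is a $0$-Ramsey hypergroup (i.e., a recurrent hypergroup): for every finite partition $\mathbb{Z}_+=\bigcup_{i=1}^rC_i$ there exist $i$ and an injective sequence $\langle x_n\rangle_{n=1}^\infty$ in $\mathbb{N}$ with range $B$ such that $\delta_F(C_i)>0$ for every nonempty finite subset $F$ of $B$.
   Context: Let $\mathbf P=(P_n)_{n\in\mathbb{Z}_+}$ be an orthogonal polynomial system ($\deg P_n=n$), normalized so that the linearization coefficients $g(n,m;k)$ in $P_nP_m=\sum_{k=|n-m|}^{n+m}g(n,m;k)P_k$ sum to $1$, with $g(n,m;k)\ge0$ for all $n,m$ and $|n-m|\le k\le n+m$. The polynomial hypergroup $K_{\mathbf P}$ is $\mathbb{Z}_+$ with convolution $\delta_n*\delta_m=\sum_{k}g(n,m;k)\delta_k$ (extended bilinearly), identity $0$. For an injective sequence $\langle x_n\rangle$ in $\mathbb{Z}_+\setminus\{0\}$ with range $B$ and nonempty finite $F=\{x_{n_1},\dots,x_{n_m}\}\subset B$ with $n_1<\dots<n_m$, $\delta_F=\delta_{x_{n_1}}*\cdots*\delta_{x_{n_m}}$. *)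

(* Defs.v *)
From HB Require Import structures.
From mathcomp Require Import all_boot all_order all_algebra.
From mathcomp Require Import all_classical all_reals all_analysis.
Set Implicit Arguments.
Unset Strict Implicit.
Unset Printing Implicit Defensive.
Import Order.TTheory GRing.Theory Num.Theory.
Local Open Scope classical_set_scope.
Local Open Scope ring_scope.

(* A discrete hypergroup on K is given by its identity e and by the function
   conv, where conv x y : K -> R is the mass function of delta_x * delta_y.
   Finitely supported measures on K are identified with their mass functions,
   so all the sums over \in below have finitely many nonzero terms. *)
Section DiscreteConvolution.
Variables (R : realType) (K : choiceType).
Implicit Types (conv : K -> K -> K -> R) (mu nu : K -> R) (A : set K).

Definition pointmass (a : K) : K -> R := fun k => (k == a)%:R.

Definition mass mu A : R := \sum_(k \in A) mu k.

Definition mconv conv mu nu : K -> R := fun k =>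
  \sum_(x \in [set: K]) \sum_(y \in [set: K]) mu x * nu y * conv x y k.

(* delta_{y_1} * ... * delta_{y_m}, associated to the left; the empty list,
   never used below, is sent to delta_e. *)
Definition delta_seq (e : K) conv (s : seq K) : K -> R :=
  if s is y :: t then foldl (mconv conv) (pointmass y) (map pointmass t)
  else pointmass e.

(* The nonempty finite subsets F = {x_{n_1}, ..., x_{n_m}}, n_1 < ... < n_m, of
   the range of the injective sequence x are enumerated by their strictly
   increasing index lists s = [:: n_1; ...; n_m].  The cells of a partition may
   be empty. *)
Definition zero_Ramsey (e : K) conv : Prop :=
  forall (r : nat) (C : 'I_r -> set K),
    \bigcup_(i in [set: 'I_r]) C i = [set: K] -> trivIset [set: 'I_r] C ->
    exists (i : 'I_r) (x : nat -> K),
      [/\ injective x, (forall n, x n <> e)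
        & forall s : seq nat, s <> [::] -> sorted ltn s ->
            0 < mass (delta_seq e conv [seq x n | n <- s]) (C i)].

End DiscreteConvolution.

Section PolynomialHypergroup.
Variable R : realType.
Implicit Types (P : nat -> {poly R}) (g : nat -> nat -> nat -> R).

(* Orthogonality with respect to a positive Borel measure on the line with
   finite moments of all orders (order 0: the measure is finite); positivity of
   the norms forces its support to be infinite. *)
Definition orthogonal_system P : Prop :=
  (forall n, size (P n) = n.+1) /\
  exists mu : {measure set (measurableTypeR R) -> \bar R},
    [/\ forall n, mu.-integrable setT (fun x : measurableTypeR R => (x ^+ n)%:E),
        forall n m, n <> m -> (\int[mu]_x ((P n).[x] * (P m).[x])%:E = 0)%E
      & forall n, (0 < \int[mu]_x ((P n).[x] ^+ 2)%:E)%E].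

(* Only the values g n m k with |n - m| <= k <= n + m are meaningful; they are
   determined by P, since the P_k form a basis of the polynomials. *)
Definition polynomial_hypergroup P g : Prop :=
  [/\ orthogonal_system P,
      forall n m : nat, P n * P m = \sum_(`|n - m|%N <= k < (n + m).+1%N) g n m k *: P k,
      forall n m : nat, \sum_(`|n - m|%N <= k < (n + m).+1%N) g n m k = 1
    & forall n m k : nat, (`|n - m| <= k <= n + m)%N -> 0 <= g n m k].

Definition poly_conv g (n m : nat) : nat -> R := fun j =>
  \sum_(`|n - m|%N <= k < (n + m).+1%N) g n m k * pointmass R k j.

End PolynomialHypergroup.

(* Main.v *)
Require Import Defs.
From HB Require Import structures.
From mathcomp Require Import all_boot all_order all_algebra.
From mathcomp Require Import all_classical all_reals all_analysis.
From mathcomp Require Import zify.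

(** By degrees, [g n m (n + m)] is nonzero, hence positive, so the measure
    [delta_F] charges the integer [sum F].  The theorem therefore follows from
    Hindman's theorem: some cell contains all the finite sums of an increasing
    sequence.  The latter is proved with an idempotent ultrafilter on [nat].
    A filter stands for the closed set of the ultrafilters that contain it, so
    that the compact subsemigroups of the Ellis-Numakura argument are the proper
    filters [F] with [F `<=` filter_add F F], and Zorn's lemma gives a maximal
    one. *)

Set Implicit Arguments.
Unset Strict Implicit.
Unset Printing Implicit Defensive.
Import Order.TTheory GRing.Theory Num.Theory.
Local Open Scope classical_set_scope.

(** * Idempotent ultrafilters and Hindman's finite sums theorem *)

Section Hindman.
Implicit Types (A B D : set nat) (F G p : set_system nat).

Definition translate A a : set nat := [set b | A (a + b)%N].

(** On ultrafilters this is the addition of the Stone-Cech compactification of [nat]. *)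
Definition filter_add F G : set_system nat :=
  [set A | F [set a | G (translate A a)]].

Lemma translateD A a b : translate A (a + b)%N = translate (translate A a) b.
Proof. by apply/funext => c; rewrite /translate /= addnA. Qed.

Lemma translateI A B a : translate (A `&` B) a = translate A a `&` translate B a.
Proof. by []. Qed.

Lemma filter_add_filter F G : ProperFilter F -> ProperFilter G ->
  ProperFilter (filter_add F G).
Proof.
move=> FF GG; split.
  rewrite /filter_add /= => F0; apply: (@filter_not_empty _ F).
  by apply: filterS F0 => a /= /filter_not_empty.
split.
- rewrite /filter_add /=; apply: filterS filterT => a _.
  exact: filterS filterT.
- move=> A B; rewrite /filter_add /=; apply: filterS2 => a /= GA GB.
  by rewrite translateI; apply: filterI.
- move=> A B AB; rewrite /filter_add /=; apply: filterS => a /=.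
  by apply: filterS => b; apply: AB.
Qed.

Lemma filter_addSS F F' G G' : Filter F' ->
  F `<=` F' -> G `<=` G' -> filter_add F G `<=` filter_add F' G'.
Proof.
move=> FF' FF GG A /FF; rewrite /filter_add /=.
by apply: filterS => a; apply: GG.
Qed.

(** If ultrafilters [p] and [q] contain [F], so does [filter_add p q], by [filter_addSS]: the
    ultrafilters containing [F] form a closed subsemigroup. Containing [\oo] excludes the principal
    ones, in particular the trivial idempotent at 0. *)
Definition subsemigroup_filter F :=
  [/\ ProperFilter F, \oo `<=` F & F `<=` filter_add F F].

Lemma eventually_subsemigroup : subsemigroup_filter \oo.
Proof.
split=> [|//|A [N _ NA]]; first exact: eventually_filter.
exists 0%N => // a _; exists N => // b /= Nb.
by apply: NA => /=; rewrite (leq_trans Nb) // leq_addl.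
Qed.

Lemma maximal_subsemigroup_filter : exists F, subsemigroup_filter F /\
  forall G, subsemigroup_filter G -> F `<=` G -> G = F.
Proof.
pose ok : set (set_system nat) := [set F | F = set0 \/ subsemigroup_filter F].
have chain_ok (Fs : set (set_system nat)) :
    Fs `<=` ok -> total_on Fs subset -> ok (\bigcup_(X in Fs) X).
  move=> Fsok Fstot; have [allFs0|] := pselect (forall X, Fs X -> X = set0).
    by left; apply/seteqP; split=> // A [X /allFs0->].
  move=> /existsNP[X /not_implyP[FsX X0]]; right.
  have sgF Y A : Fs Y -> Y A -> subsemigroup_filter Y.
    by move=> /Fsok[->|].
  have [//|[Xpr ooX XX]] := Fsok _ FsX.
  split.
  - split; first by move=> [Y FsY Y0]; case: (sgF _ _ FsY Y0) => /filter_not_empty.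
    split.
    + by exists X => //; apply: filterT.
    + move=> A B [Y FsY YA] [Z FsZ ZB].
      have [YZ|ZY] := Fstot _ _ FsY FsZ.
        have [? _ _] := sgF _ _ FsZ ZB.
        by exists Z => //; apply: filterI => //; apply: YZ.
      have [? _ _] := sgF _ _ FsY YA.
      by exists Y => //; apply: filterI => //; apply: ZY.
    + move=> A B AB [Y FsY YA]; have [? _ _] := sgF _ _ FsY YA.
      by exists Y => //; apply: filterS YA.
  - by move=> A /ooX XA; exists X.
  - move=> A [Y FsY YA]; have [? _ YY] := sgF _ _ FsY YA.
    exists Y => //; have := YY _ YA; rewrite /filter_add /=.
    by apply: filterS => a Ya; exists Y.
have [F [okF maxF]] := Zorn_bigcup chain_ok.
have maxE G : subsemigroup_filter G -> F `<=` G -> G = F.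
  move=> sgG FG; apply: contrapT => GF; apply: (maxF G); last by right.
  by split=> // GF'; apply: GF; apply/seteqP.
exists F; split=> //; case: okF => // F0.
have := maxE _ eventually_subsemigroup; rewrite F0 => /(_ (@sub0set _ _)) oo0.
have : (\oo : set_system nat) setT by apply: filterT.
by rewrite oo0.
Qed.

(** Let S be the set of ultrafilters containing a maximal [F], and [p] in S. Maximality gives S + p
    = S, then q + p = p for all q in S, in particular for q = p. *)
Lemma idempotent_ultrafilter : exists p,
  [/\ UltraFilter p, \oo `<=` p & p `<=` filter_add p p].
Proof.
have [F [[Fpr ooF FF] maxF]] := maximal_subsemigroup_filter.
have [p [pU Fp]] := ultraFilterLemma Fpr.
pose G := filter_add F p.
have FG : F `<=` G by move=> A /FF; apply: filter_addSS.
(* [G] is the analogue of the closed subsemigroup [S + p] of [S]. *)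
have GF : G = F.
  apply: maxF => //; split; first by apply: filter_add_filter; case: pU.
    by move=> A /ooF /FG.
  move=> A /FF GA; apply: FG; move: GA; rewrite /G /filter_add /=.
  apply: filterS => a /=; apply: filterS => b /=.
  by rewrite -translateD.
pose star A := [set a | p (translate A a)].
(* [H] is the analogue of the closed subsemigroup of the [q] in [S] with
   [q + p = p]. *)
pose H : set_system nat :=
  [set B | exists2 A, p A & exists2 D, F D & D `&` star A `<=` B].
have FH : F `<=` H.
  by move=> D FD; exists setT; [apply: filterT|exists D => // a []].
have Hstar B : p B -> H (star B).
  move=> pB; exists B => //; exists setT; first exact: filterT.
  by move=> x [].
have HI : setI_closed H.
  move=> B B' [A pA [D FD DB]] [A' pA' [D' FD' DB']].
  exists (A `&` A'); first exact: filterI.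
  exists (D `&` D'); first exact: filterI.
  move=> a [[Da D'a]]; rewrite /star /= translateI => pAA'.
  by split; [apply: DB | apply: DB']; split=> //; apply: filterS pAA' => b [].
have HS B B' : B `<=` B' -> H B -> H B'.
  by move=> BB' [A pA [D FD DB]]; exists A => //; exists D => // a /DB /BB'.
have HF : H = F.
  apply: maxF => //; split.
  - split; last by split=> //; apply: FH; apply: filterT.
    (* If [D] and [star A] were disjoint, the complement of [A] would lie in [G], which is [F],
       hence in [p] along with [A]. *)
    move=> [A pA [D FD DA0]].
    have : G (~` A).
      rewrite /G /filter_add /=; apply: filterS FD => a Da.
      have [pAa|//] := in_ultra_setVsetC (translate A a) pU.
      by case: (DA0 a).
    rewrite GF => /Fp pnA; apply: (@filter_not_empty _ p).
    by rewrite -(setICr A); apply: filterI.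
  - by move=> A /ooF /FH.
  - move=> B [A pA [D FD DB]]; rewrite /filter_add /=.
    (* For [b] in this set, [translate B b] contains the intersection of [translate D b], a member
       of [F], with [star (translate A b)], where [translate A b] is in [p]. *)
    apply: (HS ([set a | F (translate D a)] `&` star A)).
      move=> b [/= /FH FDb /Hstar Hb].
      apply: HS (HI _ _ FDb Hb) => a /= [Da pa]; apply: DB; split=> //.
      by rewrite /star /= translateD.
    by apply: HI; [apply/FH/FF | apply: Hstar].
exists p; split=> //; first by move=> A /ooF /Fp.
by move=> A /Hstar; rewrite HF => /Fp.
Qed.

Lemma ultrafilter_cover (T : Type) (q : set_system T) r (C : 'I_r -> set T) :
  UltraFilter q -> \bigcup_i C i = setT -> exists i, q (C i).
Proof.
move=> qU CT; apply: contrapT => /forallNP nC.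
apply: (@filter_not_empty _ q).
have : q [set x | forall i, (~` C i) x].
  apply: filter_forall => i.
  by have [/nC|] := in_ultra_setVsetC (C i) qU.
apply: filterS => x xC; have : setT x by [].
by rewrite -CT => -[i _ /xC].
Qed.

(** Galvin-Glazer argument: the state is the last term chosen and a set of [p] in which all later
    finite sums must stay. Idempotence of [p] allows a next term [a] for which [translate A a] is
    again in [p]. *)
Theorem hindman r (C : 'I_r -> set nat) : \bigcup_i C i = setT ->
  exists i (x : nat -> nat), [/\ (forall n, (0 < x n)%N),
    (forall n, (x n < x n.+1)%N) &
    forall s, s <> [::] -> sorted ltn s -> C i (\sum_(n <- s) x n)%N].
Proof.
move=> CT; have [p [pU oop pp]] := idempotent_ultrafilter.
have [i pC] := ultrafilter_cover pU CT.
pose good N A a := [/\ (N < a)%N, A a & p (translate A a)].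
have goodP N A : exists a, p A -> good N A a.
  have [pA|npA] := pselect (p A); last by exists 0%N.
  suff /filter_ex[a Aa] : p [set a | good N A a] by exists a.
  have pN : p [set a | (N < a)%N] by apply: oop; exists N.+1.
  by apply: filterS3 pN pA (pp _ pA).
have /choice[pick pickP] : forall NA : nat * set nat,
    exists a, p NA.2 -> good NA.1 NA.2 a.
  by move=> [N A]; apply: goodP.
pose step (NA : nat * set nat) :=
  (pick NA, NA.2 `&` translate NA.2 (pick NA)).
pose st n := iter n step (0%N, C i).
pose x n := pick (st n).
have pst n : p (st n).2.
  elim: n => //= n IH; apply: filterI => //.
  by have [] := pickP _ IH.
have stP n : good (st n).1 (st n).2 (x n) by apply: pickP.
have st_dec m n : (m <= n)%N -> (st n).2 `<=` (st m).2.
  elim: n => [|n IH]; first by rewrite leqn0 => /eqP->.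
  by rewrite leq_eqVlt => /orP[/eqP->//|/IH mn] a [/mn].
have sumP s n : s <> [::] -> sorted ltn s -> all (leq n) s ->
    (st n).2 (\sum_(k <- s) x k)%N.
  elim: s n => // a s IH n _ /= pas /andP[na _].
  (* The sum over the tail lies in [(st a.+1).2], hence in [translate (st a).2 (x a)]; adding [x a]
     leads back into [(st a).2]. *)
  apply: (st_dec _ _ na); rewrite big_cons.
  case: s => [|b s] in IH pas *.
    by rewrite big_nil addn0; have [] := stP a.
  suff [] : (st a.+1).2 (\sum_(k <- b :: s) x k)%N by [].
  apply: IH => //; first by case/andP: pas.
  by move: pas; rewrite path_sortedE; [case/andP | exact: ltn_trans].
exists i, x; split.
- by move=> n; have [+ _ _] := stP n; apply: leq_ltn_trans.
- by move=> n; have [] := stP n.+1.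
- by move=> s s0 ss; apply: (sumP s 0%N) => //; apply/allP.
Qed.

End Hindman.

Local Open Scope ring_scope.

(** * Largest point of the support of a convolution *)

Section PositiveTop.
Variables (R : realType) (conv : nat -> nat -> nat -> R).
Hypothesis conv_ge0 : forall n m k, 0 <= conv n m k.
Hypothesis conv_top : forall n m, 0 < conv n m (n + m)%N.
Hypothesis conv_big : forall n m k, (n + m < k)%N -> conv n m k = 0.

(** The bound on the support reduces the sums over [nat] in [mconv] and [mass] to finite ones. *)
Definition top_at (mu : nat -> R) N :=
  [/\ forall k, 0 <= mu k, 0 < mu N & forall k, (N < k)%N -> mu k = 0].

Lemma pointmass_top n : top_at (pointmass R n) n.
Proof.
split=> [k||k nk]; rewrite /pointmass; first by case: eqP.
  by rewrite eqxx.
by rewrite gtn_eqF.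
Qed.

Lemma mconv_pointmass mu m k :
  mconv conv mu (pointmass R m) k = \sum_(n \in [set: nat]) mu n * conv n m k.
Proof.
apply: eq_fsbigr => n _; rewrite (fsbigE [:: m]) //=.
  by rewrite big_mkcond big_seq1 in_setT /pointmass eqxx mulr1.
move=> y _; rewrite inE /pointmass => /negPf->.
by rewrite mulr0 mul0r.
Qed.

(** At [N + m] the term [n = N] is positive and the others are nonnegative; beyond it every term
    with [n <= N] vanishes. *)
Lemma mconv_top mu N m :
  top_at mu N -> top_at (mconv conv mu (pointmass R m)) (N + m).
Proof.
move=> [mu0 muN muB].
have E k : mconv conv mu (pointmass R m) k = \sum_(0 <= n < N.+1) mu n * conv n m k.
  rewrite mconv_pointmass (fsbigE (index_iota 0 N.+1)) ?iota_uniq //.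
    by apply: eq_bigl => n; rewrite in_setT.
  by move=> n _; rewrite mem_index_iota /= ltnS -ltnNge => /muB->; rewrite mul0r.
split=> [k||k Nk]; rewrite E.
- by apply: sumr_ge0 => n _; rewrite mulr_ge0.
- rewrite big_nat_recr //= ltr_wpDl ?mulr_gt0 //.
  by apply: sumr_ge0 => n _; rewrite mulr_ge0.
- rewrite big_nat_cond big1 // => n /andP[nN _].
  by rewrite conv_big ?mulr0 //; lia.
Qed.

Lemma delta_seq_top e s :
  s <> [::] -> top_at (delta_seq e conv s) (\sum_(n <- s) n)%N.
Proof.
case: s => // y s _ /=; rewrite big_cons.
(* The accumulator of [foldl] must be an arbitrary measure for the induction. *)
move: (pointmass R y) (pointmass_top y) => mu.
elim: s mu y => [|z s IH] mu N muN /=.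
  by rewrite big_nil addn0.
by rewrite big_cons addnA; apply: IH; apply: mconv_top.
Qed.

Lemma mass_top mu N (A : set nat) : top_at mu N -> A N -> 0 < mass mu A.
Proof.
move=> [mu0 muN muB] AN.
rewrite /mass (fsbigE [seq n <- iota 0 N.+1 | n \in A]).
- rewrite big_mkcond (bigD1_seq N) ?filter_uniq ?iota_uniq //; last first.
    by rewrite mem_filter mem_set // mem_iota add0n ltnS leqnn.
  rewrite mem_set // ltr_wpDr // sumr_ge0 // => n _.
  by case: ifP.
- by rewrite filter_uniq ?iota_uniq.
- by move=> n; rewrite /mkset mem_filter => /andP[/set_mem].
- move=> n An; rewrite mem_filter mem_set // mem_iota add0n ltnS -ltnNge.
  exact: muB.
Qed.

End PositiveTop.

(** * Positivity of the top linearization coefficient *)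

Section PolynomialHypergroup.
Variables (R : realType) (g : nat -> nat -> nat -> R).

Lemma poly_convE (n m j : nat) :
  (`|n - m| <= j <= n + m)%N -> poly_conv g n m j = g n m j.
Proof.
move=> jnm; rewrite /poly_conv (bigD1_seq j) ?iota_uniq ?mem_index_iota //=.
rewrite /pointmass eqxx mulr1 big1 ?addr0 // => k kj.
by rewrite eq_sym (negPf kj) mulr0.
Qed.

Lemma poly_conv_out (n m j : nat) :
  ~~ (`|n - m| <= j <= n + m)%N -> poly_conv g n m j = 0.
Proof.
move=> jnm; rewrite /poly_conv big_nat_cond big1 // => k /andP[knm _].
rewrite /pointmass (_ : j == k = false) ?mulr0 //.
by apply: contraNF jnm => /eqP->.
Qed.

Lemma linearization_top (P : nat -> {poly R}) n m :
  polynomial_hypergroup P g -> 0 < g n m (n + m)%N.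
Proof.
case=> -[szP _] PE _ g0.
have nm : (`|n - m| <= n + m)%N by lia.
rewrite lt_neqAle g0 ?nm ?leqnn // andbT eq_sym; apply/eqP => gnm0.
(* Without its last term the expansion has degree below [n + m], the degree of [P n * P m]. *)
have := PE n m; rewrite big_nat_recr //= gnm0 scale0r addr0 => E.
have : (size (P n * P m)%R <= n + m)%N.
  rewrite E; apply: (leq_trans (size_sum _ _ _)).
  rewrite big_nat_cond; apply/bigmax_leqP_seq => k _ /andP[/andP[_ knm] _].
  by rewrite (leq_trans (size_scale_leq _ _)) // szP.
by rewrite size_mul -?size_poly_eq0 ?szP //; lia.
Qed.

End PolynomialHypergroup.

Theorem theorem4p4 (R : realType) (P : nat -> {poly R})
    (g : nat -> nat -> nat -> R) (hP : polynomial_hypergroup P g) :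
  zero_Ramsey 0%N (poly_conv g).
Proof.
move=> r C CT _; have [i [x [x0 xS xC]]] := hindman CT.
exists i, x; split.
- have xmono : {homo x : m n / (m < n)%N} by apply: homo_ltn => //; exact: ltn_trans.
  by move=> m n xmn; have [/xmono|/xmono|//] := ltngtP m n; rewrite xmn ltnn.
- by move=> n xn0; have := x0 n; rewrite xn0.
- move=> s s0 ss; apply: mass_top (xC s s0 ss).
  rewrite -(big_map x xpredT id); apply: delta_seq_top; last by case: s s0 {ss}.
  + move=> n m k; case: (boolP (`|n - m| <= k <= n + m)%N) => nmk.
      by rewrite (poly_convE g nmk); case: hP => _ _ _; apply.
    by rewrite (poly_conv_out g nmk).
  + by move=> n m; rewrite poly_convE ?(linearization_top _ _ hP) //; lia.
  + by move=> n m k nmk; rewrite poly_conv_out //; lia.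
Qed.
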